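(* Let $n\geq 3$ and $1\leq k<n/2$ be integers, and let $$A_1=\begin{pmatrix}2&1\\1&2\end{pmatrix},\quad A_2=\begin{pmatrix}2&1\\2&1\end{pmatrix},\quad A_3=\begin{pmatrix}1&2\\2&1\end{pmatrix},\quad A_4=\begin{pmatrix}0&3\\1&2\end{pmatrix},\quad A_5=\begin{pmatrix}0&3\\2&1\end{pmatrix},\quad A_6=\begin{pmatrix}0&3\\3&0\end{pmatrix}.$$ Up to interchanging the two colors, every quotient matrix of a perfect $2$-coloring of the generalized Petersen graph $GP(n,k)$ is one of $A_1,\ldots,A_6$, and these matrices occur as quotient matrices of perfect $2$-colorings of $GP(n,k)$ exactly as follows: (1) $A_1$ occurs for all integers $n,k$ satisfying $n\geq 3$ and $1\leq k<n/2$; (2) $A_2$ occurs if and only if $3\mid n$ and $3\nmid k$; (3) $A_3$ occurs if and only if $2\mid n$ and $k$ is odd; (4) $A_4$ occurs if and only if $4\mid n$ and $k$ is odd; (5) $A_5$ occurs if and only if $5\mid n$ and $k\equiv \pm 2\pmod 5$; (6) $A_6$ occurs if and only if $2\mid n$ and $k$ is odd.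
   Context: For integers $n\ge 3$ and $1\le k<n/2$, the generalized Petersen graph $GP(n,k)$ is the (cubic, connected) graph with vertex set $\{a_i,b_i: i\in\mathbb Z_n\}$ and edge set $\{a_ia_{i+1},\ a_ib_i,\ b_ib_{i+k}: i\in\mathbb Z_n\}$, with indices read modulo $n$. A perfect $2$-coloring of a graph $G$ is a map $T:V(G)\to\{1,2\}$ in which both colors are used (nontrivial coloring) and for which there is a matrix $S=(s_{ij})_{i,j\in\{1,2\}}$ such that every vertex of color $i$ has exactly $s_{ij}$ neighbours of color $j$, for all $i,j\in\{1,2\}$. The matrix $S$ is called the quotient matrix of $T$. Interchanging the two colors replaces $\begin{pmatrix} a & b \\ c & d \end{pmatrix}$ by $\begin{pmatrix} d & c \\ b & a \end{pmatrix}$. A matrix ''occurs'' for $GP(n,k)$ if it is the quotient matrix of some perfect $2$-coloring of $GP(n,k)$. *)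

(* Defs.v *)
From mathcomp Require Import all_boot all_algebra.

Set Implicit Arguments.
Unset Strict Implicit.
Unset Printing Implicit Defensive.

(* [inl i] is the outer vertex a_i and [inr i] the inner vertex b_i.  The
   index type is 'I_n with explicit reduction mod n. *)
Definition GPvertex (n : nat) : finType := ('I_n + 'I_n)%type.

Definition GParc (n k : nat) : rel (GPvertex n) := fun u v =>
  match u, v with
  | inl i, inl j => nat_of_ord j == (i + 1) %% n
  | inl i, inr j => i == j
  | inr i, inr j => nat_of_ord j == (i + k) %% n
  | inr _, inl _ => false
  end.

Definition GP (n k : nat) : rel (GPvertex n) := fun u v =>
  GParc k u v || GParc k v u.

(* The colors 1 and 2 are the elements 0 and 1 of 'I_2. *)
Definition quotient_matrix (V : finType) (e : rel V)
    (T : V -> 'I_2) (S : 'M[nat]_2) : Prop :=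
  forall (u : V) (j : 'I_2), #|[set v | e u v & T v == j]| = S (T u) j.

Definition perfect_2coloring (V : finType) (e : rel V)
    (T : V -> 'I_2) : Prop :=
  (forall c : 'I_2, exists v : V, T v = c) /\
  (exists S : 'M[nat]_2, quotient_matrix e T S).

Definition occurs (V : finType) (e : rel V) (S : 'M[nat]_2) : Prop :=
  exists T : V -> 'I_2, perfect_2coloring e T /\ quotient_matrix e T S.

(* [rev_ord] exchanges the two elements of 'I_2, so this sends
   (a b; c d) to (d c; b a). *)
Definition swap_colors (S : 'M[nat]_2) : 'M[nat]_2 :=
  \matrix_(i, j) S (rev_ord i) (rev_ord j).

Definition mx22 (a b c d : nat) : 'M[nat]_2 :=
  \matrix_(i < 2, j < 2) nth 0 (nth [::] [:: [:: a; b]; [:: c; d]] i) j.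

Definition A1 : 'M[nat]_2 := mx22 2 1
                                  1 2.
Definition A2 : 'M[nat]_2 := mx22 2 1
                                  2 1.
Definition A3 : 'M[nat]_2 := mx22 1 2
                                  2 1.
Definition A4 : 'M[nat]_2 := mx22 0 3
                                  1 2.
Definition A5 : 'M[nat]_2 := mx22 0 3
                                  2 1.
Definition A6 : 'M[nat]_2 := mx22 0 3
                                  3 0.

(* Main.v *)
Require Import Defs.
From mathcomp Require Import all_boot all_algebra.
From mathcomp Require Import zify.

(** Since both off-diagonal entries of a quotient matrix are positive (the
    graph is connected) and its rows sum to 3, only nine matrices remain: the
    matrices of the list and their color swaps.  All the required colorings
    are periodic in the index, with period 1, 2, 3, 4 or 5, and are checked on
    one period ([periodic_occurs]).

    For the converse, let f be the indicator of one color.  For a suitable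
    color, each of the six matrices says that w * f v plus the sum of f over
    the neighbors of v is a constant c.  Summing this equation over the outer
    cycle and over the inner vertices shows that both contain the same number
    a of vertices of that color, with (w + 3) * a = n * c
    ([coloring_density]); this gives every divisibility condition on n.

    For the conditions on k, put the vertices of index x + k y at the point
    (x, y) of the integer plane.  Outer edges become horizontal, inner edges
    vertical, and the coloring becomes a solution (A, B) of the local equation
    [grid] in an infinite graph with many symmetries: translations, reflections
    and the exchange of the outer vertices with the inner ones, which exchanges
    the axes.  It moreover satisfies [helical]: going k steps to the right
    amounts to going one step up.  The local equation is rigid, and a pattern
    repeated horizontally until k steps have been made must agree with the
    vertical neighbor:
    - for A2 and A4, a vertex of the color counted forces one of the same color
      in the other layer, at horizontal distance 3 or 2 respectively; so k is
      not a multiple of that distance ([step_not_dvd]);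
    - for A5, rows have period 5 and contain two consecutive inner vertices of
      the color counted, which excludes k = 0, 1, -1 modulo 5
      ([mod5_of_grid]);
    - for A6 the colors alternate in both directions;
    - for A3, a spoke with two ends of the same color propagates, changing its
      color, either along a whole row or by a fixed knight move, both to the
      right and upwards; comparing the two directions makes k odd
      ([spoke_odd]).  Without such spokes each layer has its colors exchanged
      by two steps in either direction, with the same conclusion. *)

Set Implicit Arguments.
Unset Strict Implicit.
Unset Printing Implicit Defensive.
Import GRing.Theory.
Local Open Scope ring_scope.

(** * Two-colorings of the unrolled graph *)

(** [A x y] and [B x y] tell whether the outer and the inner vertex of index
    x + k y have the chosen color. *)
Definition grid (w c : nat) (A B : int -> int -> bool) : Prop :=
  (forall x y, w * A x y + A (x - 1)%R y + A (x + 1)%R y + B x y = c)%N /\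
  (forall x y, w * B x y + B x (y - 1)%R + B x (y + 1)%R + A x y = c)%N.

Lemma grid_row w c A B : grid w c A B -> forall xl x xr y,
  xl = x - 1 -> xr = x + 1 -> (w * A x y + A xl y + A xr y + B x y = c)%N.
Proof. by move=> [hA _] xl x xr y -> ->; apply: hA. Qed.

Lemma grid_col w c A B : grid w c A B -> forall yl y yr x,
  yl = y - 1 -> yr = y + 1 -> (w * B x y + B x yl + B x yr + A x y = c)%N.
Proof. by move=> [_ hB] yl y yr x -> ->; apply: hB. Qed.

Lemma grid_shift w c A B x0 y0 : grid w c A B ->
  grid w c (fun x y => A (x0 + x) (y0 + y)) (fun x y => B (x0 + x) (y0 + y)).
Proof.
by move=> [hA hB]; split=> x y; rewrite !addrA; [apply: hA | apply: hB].
Qed.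

Lemma grid_flipx w c A B : grid w c A B ->
  grid w c (fun x y => A (- x) y) (fun x y => B (- x) y).
Proof.
move=> [hA hB]; split=> x y; last exact: hB.
by have := hA (- x) y; rewrite /= !opprD opprK (addnAC (w * _)%N).
Qed.

Lemma grid_swap w c A B : grid w c A B ->
  grid w c (fun x y => B y x) (fun x y => A y x).
Proof. by move=> [hA hB]; split=> x y; [apply: hB | apply: hA]. Qed.

Lemma grid_flipy w c A B : grid w c A B ->
  grid w c (fun x y => A x (- y)) (fun x y => B x (- y)).
Proof. by move=> H; exact: (grid_swap (grid_flipx (grid_swap H))). Qed.

(* The neighboring coordinates are computed, so that equal vertices of
   different instances become syntactically equal. *)
Ltac row H x y :=
  let xl := eval compute in (x - 1 : int) in
  let xr := eval compute in (x + 1 : int) in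
  have := grid_row H (xl := xl) (x := x) (xr := xr) y erefl erefl.
Ltac col H x y :=
  let yl := eval compute in (y - 1 : int) in
  let yr := eval compute in (y + 1 : int) in
  have := grid_col H (yl := yl) (y := y) (yr := yr) x erefl erefl.

Lemma eqb_nat (b d : bool) : (b == d) = (b == d :> nat).
Proof. by case: b; case: d. Qed.

Lemma is_true_nat (b : bool) : is_true b = is_true (b == 1%N :> nat).
Proof. by case: b. Qed.

(** Colors become natural numbers that are at most 1, so that the local
    equations form a system of linear constraints. *)
Ltac color_lia :=
  rewrite ?eqb_nat;
  repeat match goal with |- context [is_true (?f ?x ?y)] =>
    lazymatch type of f with int -> int -> bool =>
      rewrite (is_true_nat (f x y)) end end;
  repeat match goal with |- context [nat_of_bool (?f ?x ?y)] =>
    let v := fresh "v" in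
    move: (leq_b1 (f x y)); move: (nat_of_bool (f x y)) => v end;
  lia.

(** The plane is wound around the cycle of indices: [A] depends on its two
    coordinates through the index x + k y only. *)
Definition helical (k : nat) (A : int -> int -> bool) : Prop :=
  forall x y x' y', x + k%:Z * y = x' + k%:Z * y' -> A x y = A x' y'.

Lemma alternating_walk (P : bool -> int -> int -> bool) (p q : int) :
  (forall s x y, P s x y -> P (~~ s) (x + p) (y + q)) ->
  forall (m : nat) s x y,
    P s x y -> P (s (+) odd m) (x + p * m%:Z) (y + q * m%:Z).
Proof.
move=> step m s x y Pxy.
elim: m => [|m IHm]; first by rewrite !mulr0 !addr0 addbF.
rewrite /= addbN.
have -> : x + p * m.+1%:Z = x + p * m%:Z + p by lia.
have -> : y + q * m.+1%:Z = y + q * m%:Z + q by lia.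
exact: step.
Qed.

(** * Total perfect domination and perfect codes *)

(** Here every vertex has exactly one neighbor in the set.  If (0, 2) were in
    [A] like (0, 0), then [B] would avoid (1, 0) and (1, 2), so that (1, 1) is
    in [A] because of the inner vertex at (1, 1).  Likewise (-1, 1) is in [A],
    and the outer vertex at (0, 1) has two neighbors in the set.  So (0, 2) is
    not in [A], nor (0, 1) in [B], and the inner vertex at (0, 2) needs (0, 3)
    in [B]. *)
Lemma total_domination_up A B :
  grid 0 1 A B -> A 0%Z 0%Z -> B 0%Z 3%Z.
Proof.
move=> H.
row H (-1)%Z 0%Z; row H 1%Z 0%Z; row H 0%Z 1%Z.
row H (-1)%Z 2%Z; row H 1%Z 2%Z.
col H (-1)%Z 1%Z; col H 0%Z 0%Z; col H 0%Z 2%Z; col H 1%Z 1%Z.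
color_lia.
Qed.

(** Here every closed neighborhood meets the set exactly once.  The inner
    vertex at (0, 1) is covered by (0, 1) in [A] or by (0, 2) in [B].  In the
    first case the inner vertices at (1, 1) and (-1, 1) can only be covered
    from above, by (1, 2) and (-1, 2) in [B]; then the outer vertex at (0, 2)
    cannot be covered. *)
Lemma perfect_code_up A B :
  grid 1 1 A B -> A 0%Z 0%Z -> B 0%Z 2%Z.
Proof.
move=> H.
row H (-1)%Z 0%Z; row H 0%Z 0%Z; row H 1%Z 0%Z.
row H (-1)%Z 1%Z; row H 0%Z 1%Z; row H 1%Z 1%Z.
row H (-1)%Z 2%Z; row H 0%Z 2%Z; row H 1%Z 2%Z.
col H (-1)%Z 0%Z; col H (-1)%Z 1%Z; col H 0%Z 0%Z; col H 0%Z 1%Z.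
col H 0%Z 2%Z; col H 1%Z 0%Z; col H 1%Z 1%Z.
color_lia.
Qed.

(** A vertical implication from outer to inner vertices gives, by exchanging
    the axes, a horizontal one from inner to outer vertices.  For the horizontal
    implication from outer to inner vertices, these two are combined. *)
Lemma horizontal_step w c d :
  (forall A B, grid w c A B -> A 0%Z 0%Z -> B 0%Z d) ->
  forall A B, grid w c A B ->
  forall x y, (A x y -> B (x + d) y) /\ (B x y -> A (x + d) y).
Proof.
move=> up A B H.
have upA A' B' x y : grid w c A' B' -> A' x y -> B' x (y + d).
  by move=> /(grid_shift x y) /up /=; rewrite !addr0.
have right x y : B x y -> A (x + d) y by exact: (upA _ _ y x (grid_swap H)).
split=> [Axy|]; last exact: right.
(* Down by d, right by d, up by d. *)
have := upA _ _ x (- y) (grid_flipy H); rewrite /= opprK => /(_ Axy).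
rewrite opprD opprK => /right /(upA _ _ _ _ H).
by rewrite subrK.
Qed.

(** If k = m d, then m steps of length d lead one unit up.  For odd m, an outer
    vertex in the set forces the inner one just above its inner neighbor; for
    even m, whole columns of inner vertices are in the set.  Both give an inner
    vertex two neighbors in the set. *)
Lemma step_not_dvd w k (d : nat) A B :
  grid w 1 A B -> helical k A -> helical k B ->
  (forall x y, (A x y -> B (x + d%:Z) y) /\ (B x y -> A (x + d%:Z) y)) ->
  ~~ (d %| k)%N.
Proof.
move=> H hA hB step; apply/negP=> /dvdnP[m def_k].
have [x [y Axy]] : exists x y, A x y.
  have := proj1 H 0 0; case E: (A 0 0); first by exists 0, 0.
  case E1: (A (0 - 1) 0); first by exists (0 - 1), 0.
  case E2: (A (0 + 1) 0); first by exists (0 + 1), 0.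
  case E3: (B 0 0); last by rewrite muln0.
  by exists (0 + d%:Z), 0; apply: (proj2 (step _ _)).
pose P (s : bool) u v := if s then A u v else B u v.
have walk s u v : P s u v -> P (s (+) odd m) u (v + 1).
  have swap_step t u' v' : P t u' v' -> P (~~ t) (u' + d%:Z) (v' + 0).
    by rewrite addr0; case: t; [apply: (proj1 (step _ _))
                               | apply: (proj2 (step _ _))].
  move=> /(alternating_walk swap_step m).
  have -> // : P (s (+) odd m) (u + d%:Z * m%:Z) (v + 0 * m%:Z)
             = P (s (+) odd m) u (v + 1).
  by rewrite /P; case: ifP => _; [apply: hA | apply: hB]; rewrite def_k; lia.
have Bxy : B (x + d%:Z) y by apply: (proj1 (step _ _)).
case odd_m : (odd m) walk => walk.
  have := walk true _ _ Axy; rewrite /P /=.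
  by have := proj2 H x y; rewrite Axy => + B1; rewrite B1; lia.
have B1 := walk false _ _ Bxy; have := walk false _ _ B1; move: B1 Bxy.
rewrite /P /=.
have := proj2 H (x + d%:Z) (y + 1); rewrite addrK => + b1 b0 b2.
by rewrite b0 b1 b2; lia.
Qed.

(** * Colorings in which every vertex has one neighbor of its own color *)

(** Let the spoke at (0, 0) have color 1, and suppose that [A] is 0 at (0, 2).
    Then [B] is 0 at (0, 1).  If [A] were 1 at (0, 1), [B] would be 0 at (0, 2)
    and the inner vertex there would have at most one neighbor of color 1.  So
    [A] is 0 at (0, 1) and 1 at (1, 1) and (-1, 1), and [B] is 1 at (0, 2).  For
    e = 1 and e = -1, the equations at the inner vertices (e, 0) and (e, 1)
    exclude that [B] is 1 at (e, 2), and then the outer vertex at (e, 2) must be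
    1 to have enough neighbors of color 1.  Thus the outer vertex (0, 2) of
    color 0 has three neighbors of color 1. *)
Lemma spoke_up A B : grid 1 2 A B ->
  A 0%Z 0%Z == B 0%Z 0%Z -> A 0%Z 2%Z == A 0%Z 0%Z.
Proof.
move=> H.
row H (-1)%Z 0%Z; row H 0%Z 0%Z; row H 1%Z 0%Z.
row H (-1)%Z 1%Z; row H 0%Z 1%Z; row H 1%Z 1%Z.
row H (-1)%Z 2%Z; row H 0%Z 2%Z; row H 1%Z 2%Z.
col H (-1)%Z 0%Z; col H (-1)%Z 1%Z; col H (-1)%Z 2%Z.
col H 0%Z 0%Z; col H 0%Z 1%Z; col H 0%Z 2%Z.
col H 1%Z 0%Z; col H 1%Z 1%Z; col H 1%Z 2%Z.
color_lia.
Qed.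

Lemma spoke_right A B : grid 1 2 A B ->
  A 0%Z 0%Z == B 0%Z 0%Z -> B 2%Z 0%Z == A 0%Z 0%Z.
Proof.
move=> H E; rewrite (eqP E).
by apply: (spoke_up (grid_swap H)); rewrite eq_sym.
Qed.

(** Let the spoke at (0, 0) have color 1, and suppose that [A] is 1 at (2, 1).
    The equations then determine, one after the other, the colors around
    (0, 0): [A] is 1 at (-1, 1); [B] is 1 at (1, 0) and
    (1, -1); [A] is 0 at (1, -1) and 1 at (0, -1) and (-1, -1); [B] is 1 at
    (-1, 0) and (-1, 1).  The last two and the first one make three vertices of
    color 1 in the closed neighborhood of the inner vertex at (-1, 1). *)
Lemma spoke_knight A B : grid 1 2 A B ->
  A 0%Z 0%Z == B 0%Z 0%Z -> A 2%Z 1%Z != A 0%Z 0%Z.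
Proof.
move=> H.
row H (-1)%Z (-1)%Z; row H 0%Z (-1)%Z; row H 0%Z 0%Z; row H 0%Z 1%Z.
row H 1%Z 1%Z.
col H (-1)%Z 0%Z; col H (-1)%Z 1%Z; col H 0%Z 0%Z; col H 1%Z (-1)%Z.
col H 1%Z 0%Z.
color_lia.
Qed.

(** By [spoke_right] the inner vertex at (2, 0) has the color s of the spoke,
    so one of its vertical neighbors has the other color, which is that of the
    outer vertices at (2, 1) and (2, -1). *)
Lemma next_spoke A B : grid 1 2 A B -> A 0%Z 0%Z == B 0%Z 0%Z ->
  (A 2%Z 1%Z == B 2%Z 1%Z) || (A 2%Z (-1)%Z == B 2%Z (-1)%Z).
Proof.
move=> H E; move: (E) (spoke_right H E) (spoke_knight H E).
move: (spoke_knight (grid_flipy H) E) => /=.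
col H 2%Z 0%Z.
color_lia.
Qed.

(** The equality [A x y == B x y] means that the spoke at (x, y) is
    monochromatic. *)
Definition row_isolated (A B : int -> int -> bool) : Prop :=
  forall x y, A x y == B x y -> A (x + 1) y != B (x + 1) y.

(** By [next_spoke] applied at (2, 1), the alternative is a monochromatic spoke
    at (4, 0).  If s is the color of the spoke at (0, 0), then isolation gives
    the outer vertices 0 to 3 of the row the colors s, -s, -s, s.  The neighbor
    of (3, 0) of its own color is neither (2, 0) nor, by isolation, the inner
    one, so it is (4, 0); but that outer vertex already has an inner neighbor of
    its own color. *)
Lemma knight_step A B : grid 1 2 A B -> row_isolated A B ->
  A 0%Z 0%Z == B 0%Z 0%Z -> A 2%Z 1%Z == B 2%Z 1%Z ->
  A 4%Z 2%Z == B 4%Z 2%Z.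
Proof.
move=> H N E F.
have := next_spoke (grid_shift 2%Z 1%Z H) F => /= /orP [//|E'].
move: E (spoke_right H E) (N 0%Z 0%Z) (N 3%Z 0%Z) E'.
row H 0%Z 0%Z; row H 1%Z 0%Z; row H 2%Z 0%Z; row H 3%Z 0%Z; row H 4%Z 0%Z.
rewrite /=.
color_lia.
Qed.

(** Spokes at (0, 0) and (0, 1), of colors s and -s, force one of color -s at
    (0, -1).  If no row neighbor is monochromatic, the inner vertices at
    (1, -1), (1, 0) and (1, 1) have colors -s, s and -s and the outer vertex at
    (1, 0) has color -s: the inner vertex at (1, 0) has no neighbor of its
    color. *)
Lemma column_isolated A B : grid 1 2 A B -> row_isolated A B ->
  A 0%Z 0%Z == B 0%Z 0%Z -> A 0%Z 1%Z != B 0%Z 1%Z.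
Proof.
move=> H N E.
move: E (N 0%Z 0%Z) (N 0%Z 1%Z) (N 0%Z (-1)%Z).
move: (spoke_up (grid_flipy (grid_shift 0%Z 1%Z H))) => /=.
row H 0%Z 0%Z; row H 0%Z 1%Z; row H 0%Z (-1)%Z.
col H 1%Z 0%Z; col H 0%Z 0%Z; col H 0%Z (-1)%Z; col H 0%Z 1%Z.
color_lia.
Qed.

Lemma adjacent_spokes A B : grid 1 2 A B ->
  A 0%Z 0%Z == B 0%Z 0%Z -> A 1%Z 0%Z == B 1%Z 0%Z ->
  A 1%Z 0%Z != A 0%Z 0%Z /\ A 2%Z 0%Z == B 2%Z 0%Z.
Proof.
move=> H E F; split; move: (E) F (spoke_right H E).
all: row H 0%Z 0%Z; row H 1%Z 0%Z; color_lia.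
Qed.

(** Two consecutive monochromatic spokes extend to a row of such spokes with
    alternating colors.  After k steps this row reaches the spoke above its
    starting point, which has the opposite color. *)
Lemma spoke_row_odd k A B : grid 1 2 A B -> helical k A -> helical k B ->
  forall x y, A x y == B x y -> A (x + 1) y == B (x + 1) y -> odd k.
Proof.
move=> H hA hB x y E F.
pose P s u v := [&& A u v == s, A u v == B u v & A (u + 1) v == B (u + 1) v].
have step s u v : P s u v -> P (~~ s) (u + 1) (v + 0).
  case/and3P=> /eqP <- E' F'; rewrite /P addr0 F' -addrA /=.
  have := adjacent_spokes (grid_shift u v H); rewrite /= !addr0 => /(_ E' F').
  case=> ne ->; rewrite andbT.
  by move: ne; case: (A (u + 1) v); case: (A u v).
have /(alternating_walk step k) : P (A x y) x y by rewrite /P eqxx E F.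
rewrite /P mul1r mul0r addr0.
have -> : A (x + k%:Z) y = A x (y + 1) by apply: hA; lia.
have -> : B (x + k%:Z) y = B x (y + 1) by apply: hB; lia.
case/and3P=> /eqP EA /eqP EB _.
(* The inner neighbors of a monochromatic spoke have the opposite color. *)
have := proj2 H x y; rewrite -EB EA -(eqP E).
by case: (odd k) => //; rewrite addbF; case: (A x y); lia.
Qed.

Lemma knight_walk_up A B : grid 1 2 A B -> row_isolated A B ->
  forall x y, A x y == B x y -> A (x + 2) (y + 1) == B (x + 2) (y + 1) ->
  forall m : nat,
    A (x + 2 * m%:Z) (y + m%:Z) = A x y (+) odd m /\
    B (x + 2 * m%:Z) (y + m%:Z) = A x y (+) odd m.
Proof.
move=> H N x y E F m.
pose P s u v :=
  [&& A u v == s, A u v == B u v & A (u + 2) (v + 1) == B (u + 2) (v + 1)].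
have step s u v : P s u v -> P (~~ s) (u + 2) (v + 1).
  case/and3P=> /eqP <- E' F'; rewrite /P F' -!addrA /=.
  have H' := grid_shift u v H.
  have N' : row_isolated (fun x y => A (u + x) (v + y))
                         (fun x y => B (u + x) (v + y)).
    by move=> a b; rewrite addrA; apply: N.
  have := knight_step H' N'; have := spoke_knight H'.
  rewrite /= !addr0 => /(_ E') ne /(_ E' F') ->; rewrite andbT.
  by move: ne; case: (A (u + 2) (v + 1)); case: (A u v).
have /(alternating_walk step m) : P (A x y) x y by rewrite /P eqxx E F.
by rewrite /P mul1r => /and3P[/eqP -> /eqP <- _].
Qed.

Lemma knight_walk A B : grid 1 2 A B -> row_isolated A B ->
  forall x y, A x y == B x y ->
  exists2 e : int, e = 1 \/ e = - 1 & forall m : nat,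
    A (x + 2 * m%:Z) (y + e * m%:Z) = A x y (+) odd m /\
    B (x + 2 * m%:Z) (y + e * m%:Z) = A x y (+) odd m.
Proof.
move=> H N x y E; have := next_spoke (grid_shift x y H).
rewrite /= !addr0 => /(_ E) /orP[F|F].
  exists 1; first by left.
  by move=> m; rewrite mul1r; apply: knight_walk_up.
exists (- 1); first by right.
have N' : row_isolated (fun x y => A x (- y)) (fun x y => B x (- y)).
  by move=> a b; apply: N.
move=> m; have := knight_walk_up (grid_flipy H) N' (x := x) (y := - y).
rewrite /= opprD !opprK => /(_ E F m).
by rewrite opprD opprK mulN1r.
Qed.

Lemma knight_walk_vertical A B : grid 1 2 A B -> row_isolated A B ->
  forall x y, A x y == B x y ->
  exists2 e : int, e = 1 \/ e = - 1 & forall m : nat,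
    A (x + e * m%:Z) (y + 2 * m%:Z) = A x y (+) odd m.
Proof.
move=> H N x y E.
have N' : row_isolated (fun x y => B y x) (fun x y => A y x).
  move=> a b; rewrite eq_sym => E'; rewrite eq_sym.
  have N' : row_isolated (fun x y => A (b + x) (a + y))
                         (fun x y => B (b + x) (a + y)).
    by move=> u v; rewrite addrA; apply: N.
  have := column_isolated (grid_shift b a H) N'.
  by rewrite /= !addr0; apply.
have E' : B x y == A x y by rewrite eq_sym.
have [e e1 walk] := knight_walk (grid_swap H) N' E'.
by exists e => // m; have [_ ->] := walk m; rewrite (eqP E).
Qed.

(** Suppose k even.  Isolation holds in rows by [spoke_row_odd], hence in
    columns.  The horizontal knight moves (2, e) and the vertical ones (f, 2)
    or (f, -2) translate indices by d = 2 + e k and by d' = f + 2 k or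
    f - 2 k, where d' can be chosen not to have the sign opposite to that of d.
    Then |d'| moves of the first kind and |d| of the second kind lead to the
    same index, but the color changes an odd number of times in the first case
    and an even number of times in the second one. *)
Lemma spoke_odd k A B : grid 1 2 A B -> helical k A -> helical k B ->
  (0 < k)%N -> forall x y, A x y == B x y -> odd k.
Proof.
move=> H hA hB k_gt0 x y E; apply/negPn/negP=> even_k.
have N : row_isolated A B.
  by move=> a b E'; apply/negP => /(spoke_row_odd H hA hB E'); apply/negP.
have [e e1 right] := knight_walk H N E.
have absurd (m1 m2 : nat) b :
  odd m1 -> ~~ odd m2 -> b = A x y (+) odd m1 -> b = A x y (+) odd m2 -> False.
  by move=> -> /negbTE -> ->; case: (A x y).
(* The vertical direction is chosen according to the sign of d. *)
case: e1 right => -> right.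
  have [f f1 up] := knight_walk_vertical H N E.
  pose m1 := absz (2 * k%:Z + f).
  apply: (absurd m1 (2 + k)%N _ _ _ (proj1 (right m1))).
  - by case: f1 => f1; lia.
  - by lia.
  - by rewrite -(up (2 + k)%N); apply: hA; case: f1 => f1; lia.
have N' : row_isolated (fun x y => A x (- y)) (fun x y => B x (- y)).
  by move=> a b; apply: N.
have E' : A x (- - y) == B x (- - y) by rewrite opprK.
have [f f1 down] := knight_walk_vertical (grid_flipy H) N' E'.
pose m1 := absz (2 * k%:Z - f)%R.
apply: (absurd m1 (k - 2)%N _ _ _ (proj1 (right m1))).
- by case: f1 => f1; lia.
- by lia.
- have := down (k - 2)%N; rewrite opprK => <-; apply: hA.
  have -> : m1%:Z = 2 * k%:Z - f by rewrite /m1; case: f1 => f1; lia.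
  have -> : (k - 2)%N%:Z = k%:Z - 2 by lia.
  by lia.
Qed.

Lemma no_spoke_odd k A B : grid 1 2 A B -> helical k A ->
  (forall x y, A x y != B x y) -> odd k.
Proof.
move=> H hA NS.
have right s u v : A u v == s -> A (u + 2) (v + 0) == ~~ s.
  move/eqP <-; rewrite addr0; have -> : u + 2 = u + 1 + 1 by lia.
  move: (NS (u + 1) v) (proj1 H (u + 1) v); rewrite addrK.
  by case: (A (u + 1) v); case: (B (u + 1) v); case: (A u v); case: (A _ v).
have up : A 0 (0 + 1 + 1) = ~~ A 0 0.
  move: (NS 0 0) (NS 0 (0 + 1)) (NS 0 (0 + 1 + 1)) (proj2 H 0 (0 + 1)).
  rewrite addrK; case: (A 0 0); case: (B 0 0); case: (A 0 (0 + 1));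
    case: (B 0 (0 + 1)); case: (A 0 _); case: (B 0 _) => //.
have /eqP := alternating_walk right k (eqxx (A 0 0)).
have -> : A (0 + 2 * k%:Z) (0 + 0 * k%:Z) = A 0 (0 + 1 + 1) by apply: hA; lia.
by rewrite up; case: (A 0 0); case: (odd k).
Qed.

(** * Independent sets meeting every other neighborhood twice *)

(** Rows of [A] have no two consecutive members of the set and no three
    consecutive non-members, so their gaps are 2 or 3; [B] holds exactly at the
    two inner positions of the gaps of length 3.  With gaps [0, 2] and [2, 4],
    the inner vertices at (1, e) and (3, e), e = 1 or -1, are in the set because
    of those at (1, 0) and (3, 0); so position 2 of row e lies between two gaps
    of length 3, and (2, e) is not in [B].  Then the inner vertex at (2, 0) has
    only one neighbor in the set. *)
Lemma no_two_short_gaps A B : grid 2 2 A B ->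
  A 0%Z 0%Z -> A 2%Z 0%Z -> A 4%Z 0%Z -> False.
Proof.
move=> H.
row H 0%Z 0%Z; row H 1%Z 0%Z; row H 2%Z 0%Z; row H 3%Z 0%Z; row H 4%Z 0%Z.
row H 0%Z 1%Z; row H 1%Z 1%Z; row H 2%Z 1%Z; row H 3%Z 1%Z; row H 4%Z 1%Z.
row H 0%Z (-1)%Z; row H 1%Z (-1)%Z; row H 2%Z (-1)%Z; row H 3%Z (-1)%Z.
row H 4%Z (-1)%Z.
col H 1%Z 0%Z; col H 2%Z 0%Z; col H 3%Z 0%Z.
color_lia.
Qed.

(** With gaps [0, 3] and [3, 6], the inner vertex at (3, 0) needs (3, e) in [B]
    for e = 1 or e = -1.  In row e this vertex lies in a gap of length 3, so
    (2, e) or (4, e) is in [B]; but these are adjacent to (2, 0) and (4, 0),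
    which are in [B]. *)
Lemma no_two_long_gaps A B : grid 2 2 A B ->
  A 0%Z 0%Z -> A 3%Z 0%Z -> A 6%Z 0%Z -> False.
Proof.
move=> H.
row H 0%Z 0%Z; row H 1%Z 0%Z; row H 2%Z 0%Z; row H 3%Z 0%Z; row H 4%Z 0%Z.
row H 5%Z 0%Z.
row H 2%Z 1%Z; row H 3%Z 1%Z; row H 4%Z 1%Z.
row H 2%Z (-1)%Z; row H 3%Z (-1)%Z; row H 4%Z (-1)%Z.
col H 2%Z 0%Z; col H 3%Z 0%Z; col H 4%Z 0%Z.
color_lia.
Qed.

(** Gaps of lengths 2 and 3 alternate. *)
Lemma outer_period5 A B : grid 2 2 A B -> A 0%Z 0%Z -> A 5%Z 0%Z.
Proof.
move=> H; move: (no_two_short_gaps H) (no_two_long_gaps H).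
row H 0%Z 0%Z; row H 1%Z 0%Z; row H 2%Z 0%Z; row H 3%Z 0%Z; row H 4%Z 0%Z.
row H 5%Z 0%Z.
color_lia.
Qed.

Lemma inner_period5 A B : grid 2 2 A B -> B 0%Z 0%Z -> B 5%Z 0%Z.
Proof.
move=> H.
have right x x' : x' = x + 5 -> A x 0%Z -> A x' 0%Z.
  move=> ->; have /= := outer_period5 (grid_shift x 0%Z H).
  by rewrite addr0.
move: (right (-2)%Z 3%Z erefl) (right (-1)%Z 4%Z erefl).
move: (right 1%Z 6%Z erefl) (right 2%Z 7%Z erefl).
row H (-1)%Z 0%Z; row H 0%Z 0%Z; row H 1%Z 0%Z; row H 2%Z 0%Z; row H 3%Z 0%Z.
row H 4%Z 0%Z; row H 5%Z 0%Z; row H 6%Z 0%Z.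
color_lia.
Qed.

Lemma inner_neighbor A B : grid 2 2 A B -> B 0%Z 0%Z ->
  (B 1%Z 0%Z + B (-1)%Z 0%Z = 1)%N.
Proof.
move=> H; row H 0%Z 0%Z; row H 1%Z 0%Z; row H (-1)%Z 0%Z.
color_lia.
Qed.

Lemma inner_pair A B : grid 2 2 A B -> exists x y, B x y /\ B (x + 1) y.
Proof.
move=> H.
have [y By] : exists y, B 0 y.
  move: (proj2 H 0 0); case E: (B 0 0); first by exists 0.
  case E1: (B 0 (0 - 1)); first by exists (0 - 1).
  case E2: (B 0 (0 + 1)); first by exists (0 + 1).
  by case: (A 0 0).
have := inner_neighbor (grid_shift 0 y H); rewrite /= !addr0 => /(_ By).
case E: (B 1 y); first by exists 0, y; rewrite add0r.
by case E': (B (- 1) y) => // _; exists (- 1), y; rewrite addNr.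
Qed.

(** Take inner vertices of the set at (x, y) and (x + 1, y).  By periodicity
    (x, y + 1), or (x + 1, y + 1) when k = -1 modulo 5, is in [B] if k = 0, 1 or
    -1 modulo 5, but the set is independent. *)
Lemma mod5_of_grid k A B : grid 2 2 A B -> helical k B ->
  k = 2 %[mod 5] \/ k + 2 = 0 %[mod 5].
Proof.
move=> H hB.
have [x [y [B0 B1]]] := inner_pair H.
have walk (m : nat) u v : B u v -> B (u + 5 * m%:Z) v.
  elim: m => [|m IHm] Buv; first by rewrite mulr0 addr0.
  have := inner_period5 (grid_shift (u + 5 * m%:Z) v H).
  rewrite /= !addr0 => /(_ (IHm Buv)).
  by have -> : u + 5 * m%:Z + 5 = u + 5 * m.+1%:Z by lia.
have indep u v : B u v -> B u (v + 1) -> False.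
  by move=> b0 b1; have := proj2 H u v; rewrite b0 b1; lia.
have shifted (m : nat) u u' : u' + k%:Z = u + 5 * m%:Z -> B u y -> B u' (y + 1).
  move=> Eu /(walk m) Bu.
  have -> // : B u' (y + 1) = B (u + 5 * m%:Z) y by apply: hB; lia.
pose m := (k %/ 5)%N.
have [r0|[r1|[r4|r23]]] : (k = 5 * m \/ k = 5 * m + 1 \/ k = 5 * m.+1 - 1 \/
   (k %% 5 = 2 \/ k %% 5 = 3))%N by lia.
- by case: (indep x y B0); apply: (shifted m x) => //; lia.
- by case: (indep x y B0); apply: (shifted m (x + 1)) => //; lia.
- by case: (indep (x + 1) y B1); apply: (shifted m.+1 x) => //; lia.
lia.
Qed.

(** * Proper two-colorings *)

Lemma bipartite_odd k A B : grid 3 3 A B -> helical k A -> odd k.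
Proof.
move=> H hA.
have right s u v : A u v == s -> A (u + 1) (v + 0) == ~~ s.
  move/eqP <-; move: (proj1 H u v); rewrite addr0.
  by case: (A u v); case: (A (u + 1) v); lia.
have up : A 0 1 = ~~ A 0 0.
  move: (proj1 H 0 0) (proj2 H 0 0) (proj1 H 0 1).
  by case: (A 0 1); case: (A 0 0); case: (B 0 0); case: (B 0 (0 + 1)); lia.
have /eqP := alternating_walk right k (eqxx (A 0 0)).
have -> : A (0 + 1 * k%:Z) (0 + 0 * k%:Z) = A 0 1 by apply: hA; lia.
by rewrite up; case: (A 0 0); case: (odd k).
Qed.

(** * Neighborhoods in the generalized Petersen graph *)

Lemma step_eq n d (i j : 'I_n.+1) :
  (val j == (i + d) %% n.+1)%N = (j == i + inZp d).
Proof. by rewrite -val_eqE /= modnDmr. Qed.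

(** Since 0 < 2 d < n, the two steps of length d lead to distinct vertices, so
    the graph is cubic. *)
Lemma step_neq n d (i : 'I_n.+1) :
  (0 < d)%N -> (2 * d < n.+1)%N -> i + inZp d != i - inZp d.
Proof.
move=> d_gt0 d_lt; rewrite (inj_eq (addrI i)) -addr_eq0.
rewrite -val_eqE /= modnDm modn_small; lia.
Qed.

Lemma card_GP_nbrs n k (T : GPvertex n.+1 -> 'I_2) j :
  (2 <= n)%N -> (0 < k)%N -> (2 * k < n.+1)%N ->
  (forall i, #|[set v | GP k (inl i) v & T v == j]| =
     (T (inl (i - inZp 1)%R) == j) + (T (inl (i + inZp 1)%R) == j)
     + (T (inr i) == j))%N /\
  (forall i, #|[set v | GP k (inr i) v & T v == j]| =
     (T (inr (i - inZp k)%R) == j) + (T (inr (i + inZp k)%R) == j)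
     + (T (inl i) == j))%N.
Proof.
move=> n_gt1 k_gt0 k_lt.
have card_nbrs u (s : seq (GPvertex n.+1)) : GP k u =1 mem s -> uniq s ->
    #|[set v | GP k u v & T v == j]| = count (fun v => T v == j) s.
  move=> nbrs uniq_s; rewrite -size_filter -(card_uniqP (filter_uniq _ uniq_s)).
  by apply: eq_card => v; rewrite inE mem_filter andbC nbrs.
split=> i.
  rewrite (card_nbrs _ [:: inl (i - inZp 1); inl (i + inZp 1); inr i]) /=.
  - by rewrite addn0 addnA.
  - move=> [v|v]; rewrite /GP /GParc /= !inE.
      by rewrite !step_eq orbF orbC -subr_eq [i - _ == v]eq_sym.
    by rewrite orbF eq_sym.
  - rewrite !inE /= !orbF andbT eq_sym; apply: step_neq => //; lia.
rewrite (card_nbrs _ [:: inr (i - inZp k); inr (i + inZp k); inl i]) /=.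
- by rewrite addn0 addnA.
- move=> [v|v]; rewrite /GP /GParc /= !inE //.
  by rewrite !step_eq orbF orbC -subr_eq [i - _ == v]eq_sym.
- by rewrite !inE /= !orbF andbT eq_sym; apply: step_neq.
Qed.

Lemma grid_of_coloring n k (T : GPvertex n.+1 -> 'I_2) S j w c :
  (2 <= n)%N -> (0 < k)%N -> (2 * k < n.+1)%N ->
  quotient_matrix (@GP n.+1 k) T S ->
  (forall i, w * (i == j) + S i j = c)%N ->
  exists A B, [/\ grid w c A B, helical k A & helical k B].
Proof.
move=> n_gt1 k_gt0 k_lt TS Sj.
have [outer inner] := card_GP_nbrs T j n_gt1 k_gt0 k_lt.
pose pt x y : 'I_n.+1 := inZp 1 *~ (x + k%:Z * y).
have pt_right x y : pt (x + 1) y = pt x y + inZp 1.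
  by rewrite /pt addrAC mulrzDr mulr1z.
have pt_left x y : pt (x - 1) y = pt x y - inZp 1.
  by rewrite /pt addrAC mulrzBr mulr1z.
have inZpE : inZp k = inZp 1 *~ k%:Z :> 'I_n.+1.
  by rewrite -pmulrn Zp_mulrn; apply: val_inj; rewrite /= modnMml mul1n.
have pt_up x y : pt x (y + 1) = pt x y + inZp k.
  by rewrite /pt mulrDr mulr1 addrA mulrzDr -inZpE.
have pt_down x y : pt x (y - 1) = pt x y - inZp k.
  by rewrite /pt mulrBr mulr1 addrA mulrzBr -inZpE.
exists (fun x y => T (inl (pt x y)) == j), (fun x y => T (inr (pt x y)) == j).
split; last 2 first.
- by move=> x y x' y' E; rewrite /pt E.
- by move=> x y x' y' E; rewrite /pt E.
split=> x y /=.
  by rewrite pt_left pt_right -(Sj (T (inl (pt x y)))) -TS outer !addnA.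
by rewrite pt_down pt_up -(Sj (T (inr (pt x y)))) -TS inner !addnA.
Qed.

(** Let a and b count the outer and the inner vertices of color j.  Summing
    the local equation over the outer and over the inner vertices gives
    (w + 2) a + b = n c = (w + 2) b + a, hence a = b. *)
Lemma coloring_density n k (T : GPvertex n.+1 -> 'I_2) S j w c :
  (2 <= n)%N -> (0 < k)%N -> (2 * k < n.+1)%N ->
  quotient_matrix (@GP n.+1 k) T S ->
  (forall i, w * (i == j) + S i j = c)%N ->
  (w + 3 %| n.+1 * c)%N.
Proof.
move=> n_gt1 k_gt0 k_lt TS Sj.
have [outer inner] := card_GP_nbrs T j n_gt1 k_gt0 k_lt.
pose a := (\sum_(i : 'I_n.+1) (T (inl i) == j))%N.
pose b := (\sum_(i : 'I_n.+1) (T (inr i) == j))%N.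
have shift (F : 'I_n.+1 -> nat) d : (\sum_i F (i + d)%R = \sum_i F i)%N.
  by rewrite [RHS](reindex_inj (addIr d)).
have sum_c : (\sum_(i < n.+1) c = n.+1 * c)%N by rewrite sum_nat_const card_ord.
have Ea : (w * a + (a + a + b) = n.+1 * c)%N.
  rewrite -sum_c -(eq_bigr _ (fun i _ => Sj (T (inl i)))) big_split /=.
  rewrite -big_distrr /=; congr (_ + _)%N.
  under eq_bigr do rewrite -TS outer; rewrite !big_split /=.
  by rewrite !(shift (fun i => nat_of_bool (T (inl i) == j))).
have Eb : (w * b + (b + b + a) = n.+1 * c)%N.
  rewrite -sum_c -(eq_bigr _ (fun i _ => Sj (T (inr i)))) big_split /=.
  rewrite -big_distrr /=; congr (_ + _)%N.
  under eq_bigr do rewrite -TS inner; rewrite !big_split /=.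
  by rewrite !(shift (fun i => nat_of_bool (T (inr i) == j))).
have ab : a = b.
  have : ((w + 1) * a = (w + 1) * b)%N by lia.
  by move/eqP; rewrite eqn_pmul2l ?addn1 // => /eqP.
by apply/dvdnP; exists a; rewrite -Ea -ab; lia.
Qed.

(** Connectedness, in the form of an induction principle; the spokes and the
    outer cycle suffice. *)
Lemma GP_closed_full n k (P : pred (GPvertex n.+1)) :
  (forall u v, GP k u v -> P u -> P v) -> forall u v, P u -> P v.
Proof.
move=> closed.
have spoke i : P (inl i) = P (inr i).
  by apply/idP/idP; apply: closed; rewrite /GP /GParc /= eqxx ?orbT.
have rim (m : nat) i : P (inl i) -> P (inl (i + inZp 1 *+ m)).
  elim: m => [|m IHm] Pi; first by rewrite mulr0n addr0.
  rewrite mulrSr addrA; apply: closed (IHm Pi).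
  by apply/orP; left; apply/eqP; rewrite /= modnDmr.
have rimT i i' : P (inl i) -> P (inl i').
  move=> /(rim (val (i' - i))); rewrite Zp_mulrn.
  have -> : inZp ((inZp 1 : 'I_n.+1) * val (i' - i)) = i' - i :> 'I_n.+1.
    by apply: val_inj; rewrite /= modnMml mul1n modn_mod.
  by rewrite addrC subrK.
by move=> [i|i] [i'|i']; rewrite -?spoke; apply: rimT.
Qed.

(** Otherwise the color class of [u] would be closed under adjacency, hence
    contain [v]. *)
Lemma offdiagonal_pos n k (T : GPvertex n.+1 -> 'I_2) S u v :
  quotient_matrix (@GP n.+1 k) T S -> T u != T v -> (0 < S (T u) (T v))%N.
Proof.
move=> TS Tuv; rewrite lt0n; apply/eqP=> S0; move/negP: (Tuv); apply.
rewrite eq_sym; apply: (@GP_closed_full _ k (fun x => T x == T u)) (eqxx _).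
move=> x y xy /eqP Tx; apply/negPn/negP=> Ty.
have Tyv : T y = T v.
  by move: Ty Tuv; case: (T y) => -[|[]] //; case: (T u) => -[|[]] //;
     case: (T v) => -[|[]] // *; apply: val_inj.
have := TS x (T v); rewrite Tx S0 => /eqP; rewrite cards_eq0 => /eqP/setP/(_ y).
by rewrite !inE xy Tyv eqxx.
Qed.

(** * Possible quotient matrices *)

Lemma mx22_eta (S : 'M[nat]_2) :
  S = mx22 (S ord0 ord0) (S ord0 ord_max) (S ord_max ord0) (S ord_max ord_max).
Proof.
apply/matrixP=> -[[|[|//]] i2] [[|[|//]] j2]; rewrite mxE /=;
  by congr (S _ _); apply: val_inj.
Qed.

Lemma swap_mx22 a b c d : swap_colors (mx22 a b c d) = mx22 d c b a.
Proof.
by apply/matrixP=> -[[|[|//]] i2] [[|[|//]] j2]; rewrite !mxE.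
Qed.

Lemma quotient_row_sum n k (T : GPvertex n.+1 -> 'I_2) S u :
  (2 <= n)%N -> (0 < k)%N -> (2 * k < n.+1)%N ->
  quotient_matrix (@GP n.+1 k) T S ->
  (S (T u) ord0 + S (T u) ord_max = 3)%N.
Proof.
move=> n_gt1 k_gt0 k_lt TS.
have one (x : 'I_2) : ((x == ord0) + (x == ord_max) = 1)%N.
  by case: x => -[|[|]].
rewrite -!TS.
have [outer0 inner0] := card_GP_nbrs T ord0 n_gt1 k_gt0 k_lt.
have [outer1 inner1] := card_GP_nbrs T ord_max n_gt1 k_gt0 k_lt.
case: u => i.
  rewrite outer0 outer1; move: (one (T (inr i))).
  by move: (one (T (inl (i - inZp 1)))) (one (T (inl (i + inZp 1)))); lia.
rewrite inner0 inner1; move: (one (T (inl i))).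
by move: (one (T (inr (i - inZp k)))) (one (T (inr (i + inZp k)))); lia.
Qed.

Lemma occurs_classified n k S :
  (2 <= n)%N -> (0 < k)%N -> (2 * k < n.+1)%N -> occurs (@GP n.+1 k) S ->
  exists2 A : 'M[nat]_2, A \in [:: A1; A2; A3; A4; A5; A6]
                       & S = A \/ S = swap_colors A.
Proof.
move=> n_gt1 k_gt0 k_lt [T [[surj _] TS]].
have [u Tu] := surj ord0; have [v Tv] := surj ord_max.
have := quotient_row_sum u n_gt1 k_gt0 k_lt TS.
have := quotient_row_sum v n_gt1 k_gt0 k_lt TS.
have := @offdiagonal_pos _ _ _ _ u v TS.
have := @offdiagonal_pos _ _ _ _ v u TS.
rewrite Tu Tv => /(_ isT) c_gt0 /(_ isT) b_gt0 cd ab.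
rewrite (mx22_eta S); move: ab cd b_gt0 c_gt0.
move: (S ord0 ord0) (S ord0 ord_max) (S ord_max ord0) (S ord_max ord_max).
move=> a b c d ab cd b_gt0 c_gt0.
have -> : a = (3 - b)%N by lia.
have -> : d = (3 - c)%N by lia.
have b_le : (b <= 3)%N by lia.
have c_le : (c <= 3)%N by lia.
have pick A X : A \in [:: A1; A2; A3; A4; A5; A6] ->
  X = A \/ X = swap_colors A ->
  exists2 A, A \in [:: A1; A2; A3; A4; A5; A6] & X = A \/ X = swap_colors A.
  by exists A.
case: b b_gt0 b_le {ab} => [|[|[|[|b]]]] // _ _;
  case: c c_gt0 c_le {cd} => [|[|[|[|c]]]] // _ _.
- by apply: (pick A1); [rewrite !inE eqxx ?orbT | left].
- by apply: (pick A2); [rewrite !inE eqxx ?orbT | left].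
- by apply: (pick A4); [rewrite !inE eqxx ?orbT | right; rewrite swap_mx22].
- by apply: (pick A2); [rewrite !inE eqxx ?orbT | right; rewrite swap_mx22].
- by apply: (pick A3); [rewrite !inE eqxx ?orbT | left].
- by apply: (pick A5); [rewrite !inE eqxx ?orbT | right; rewrite swap_mx22].
- by apply: (pick A4); [rewrite !inE eqxx ?orbT | left].
- by apply: (pick A5); [rewrite !inE eqxx ?orbT | left].
- by apply: (pick A6); [rewrite !inE eqxx ?orbT | left].
Qed.

(** * Periodic colorings *)

Lemma add_step_mod n d e (i : 'I_n.+1) : (d %| n.+1)%N ->
  ((i + inZp e)%R %% d = (i %% d + e %% d) %% d)%N.
Proof.
by move=> d_dvd; rewrite /= modn_dvdm // -modnDmr modn_dvdm // modnDmr modnDm.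
Qed.

Lemma sub_step_mod n d e (i : 'I_n.+1) : (d %| n.+1)%N ->
  ((i - inZp e)%R %% d = (i %% d + (d - e %% d)) %% d)%N.
Proof.
move=> d_dvd; have := add_step_mod e (i - inZp e) d_dvd; rewrite subrK => ->.
have d_gt0 : (0 < d)%N by apply: dvdn_gt0 d_dvd.
have e_lt : (e %% d < d)%N by rewrite ltn_mod.
rewrite modnDml -addnA subnKC ?modnDr ?modn_mod //; exact: ltnW.
Qed.

Definition color (b : bool) : 'I_2 := if b then ord0 else ord_max.

(** The outer and inner vertices of index i get color 1 if i mod d satisfies
    [p] and [q] respectively.  As every vertex has three neighbors, the
    first column of the matrix determines the second one. *)
Lemma periodic_occurs n k d (p q : pred nat) a c :
  (2 <= n)%N -> (0 < k)%N -> (2 * k < n.+1)%N ->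
  (d %| n.+1)%N -> (a <= 3)%N -> (c <= 3)%N ->
  all (fun r => let nbr e := [:: ((r + (d - e %% d)) %% d)%N;
                                 ((r + e %% d) %% d)%N] in
    (count p (nbr 1%N) + q r == if p r then a else c)%N &&
    (count q (nbr k) + p r == if q r then a else c)%N) (iota 0 d) ->
  has (predU p q) (iota 0 d) -> ~~ all (predI p q) (iota 0 d) ->
  occurs (@GP n.+1 k) (mx22 a (3 - a) c (3 - c)).
Proof.
move=> n_gt1 k_gt0 k_lt d_dvd a_le c_le /allP local use1.
rewrite -has_predC => use2.
have d_gt0 : (0 < d)%N by apply: dvdn_gt0 d_dvd.
pose T (v : GPvertex n.+1) :=
  match v with
  | inl i => color (p (i %% d)%N)
  | inr i => color (q (i %% d)%N)
  end.
have TS : quotient_matrix (@GP n.+1 k) T (mx22 a (3 - a) c (3 - c)).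
  have three (b0 b1 b2 b : bool) j :
      (b0 + (b1 + 0) + b2 == if b then a else c)%N ->
      ((color b0 == j) + (color b1 == j) + (color b2 == j) =
       mx22 a (3 - a) c (3 - c) (color b) j)%N.
    case: j => -[|[|//]] j2; rewrite mxE; case: b => /=;
      case: b0; case: b1; case: b2 => /=; lia.
  move=> u j; have [outer inner] := card_GP_nbrs T j n_gt1 k_gt0 k_lt.
  have r_in (i : 'I_n.+1) : (i %% d)%N \in iota 0 d.
    by rewrite mem_iota ltn_mod.
  case: u => i; have /andP[local1 local2] := local _ (r_in i).
    by rewrite outer; apply: three; rewrite sub_step_mod // add_step_mod.
  by rewrite inner; apply: three; rewrite sub_step_mod // add_step_mod.
exists T; split=> //; split; last by exists (mx22 a (3 - a) c (3 - c)).
have used r : r \in iota 0 d ->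
    (exists v, T v = color (p r)) /\ (exists v, T v = color (q r)).
  rewrite mem_iota => /= r_lt.
  have r_lt' : (r < n.+1)%N by apply: leq_trans r_lt (dvdn_leq _ d_dvd).
  by split; [exists (inl (Ordinal r_lt')) | exists (inr (Ordinal r_lt'))];
    rewrite /= modn_small.
case=> -[|[|//]] c2.
  have [r /used[usep useq] /orP[pr|qr]] := hasP use1.
    by have [v Tv] := usep; exists v; rewrite Tv pr; apply: val_inj.
  by have [v Tv] := useq; exists v; rewrite Tv qr; apply: val_inj.
have [r /used[usep useq]] := hasP use2.
rewrite /= negb_and => /orP[/negbTE pr|/negbTE qr].
  by have [v Tv] := usep; exists v; rewrite Tv pr; apply: val_inj.
by have [v Tv] := useq; exists v; rewrite Tv qr; apply: val_inj.
Qed.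

(** * The six matrices *)

Lemma occurs_grid n k (S : 'M[nat]_2) j w c :
  (2 <= n)%N -> (0 < k)%N -> (2 * k < n.+1)%N ->
  (forall i, w * (i == j) + S i j = c)%N -> occurs (@GP n.+1 k) S ->
  (w + 3 %| n.+1 * c)%N /\
  exists A B, [/\ grid w c A B, helical k A & helical k B].
Proof.
move=> n_gt1 k_gt0 k_lt Sj [T [_ TS]]; split.
  exact: coloring_density TS Sj.
exact: grid_of_coloring TS Sj.
Qed.

Lemma matching_odd k A B : grid 1 2 A B -> helical k A -> helical k B ->
  (0 < k)%N -> odd k.
Proof.
move=> H hA hB k_gt0; apply/negPn/negP=> even_k; move/negP: (even_k); apply.
apply: (no_spoke_odd H hA) => x y; apply/negP=> E.
by move/negP: even_k; apply; apply: (spoke_odd H hA hB k_gt0 E).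
Qed.

Lemma occurs_A1 n k : (1 < n)%N -> (0 < k)%N -> (2 * k < n.+1)%N ->
  occurs (@GP n.+1 k) A1.
Proof.
move=> n_gt1 k_gt0 k_lt.
apply: (periodic_occurs (d := 1) (p := predT) (q := pred0)
                        (a := 2) (c := 1)) => //.
Qed.

Lemma occurs_A2 n k : (1 < n)%N -> (0 < k)%N -> (2 * k < n.+1)%N ->
  occurs (@GP n.+1 k) A2 <-> (3 %| n.+1)%N /\ ~ (3 %| k)%N.
Proof.
move=> n_gt1 k_gt0 k_lt; split=> [|[n3 k3]].
  case/(@occurs_grid _ _ _ ord_max 0 1 n_gt1 k_gt0 k_lt).
    by case=> -[|[|//]] i2; rewrite mxE.
  rewrite muln1 => n3 [A [B [H hA hB]]]; split=> //; apply/negP.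
  exact: step_not_dvd H hA hB (horizontal_step total_domination_up H).
apply: (periodic_occurs (d := 3) (p := predC1 0%N) (q := predC1 0%N)
                        (a := 2) (c := 2)) => //.
have [km | km] : (k %% 3 = 1 \/ k %% 3 = 2)%N by lia.
all: by rewrite /= km.
Qed.

Lemma occurs_A3 n k : (1 < n)%N -> (0 < k)%N -> (2 * k < n.+1)%N ->
  occurs (@GP n.+1 k) A3 <-> (2 %| n.+1)%N /\ odd k.
Proof.
move=> n_gt1 k_gt0 k_lt; split=> [|[n2 k2]].
  case/(@occurs_grid _ _ _ ord0 1 2 n_gt1 k_gt0 k_lt).
    by case=> -[|[|//]] i2; rewrite mxE.
  move=> n2 [A [B [H hA hB]]]; split; first by lia.
  exact: matching_odd H hA hB k_gt0.
apply: (periodic_occurs (d := 2) (p := pred1 0%N) (q := pred1 0%N)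
                        (a := 1) (c := 2)) => //.
have km : (k %% 2 = 1)%N by lia.
by rewrite /= km.
Qed.

Lemma occurs_A4 n k : (1 < n)%N -> (0 < k)%N -> (2 * k < n.+1)%N ->
  occurs (@GP n.+1 k) A4 <-> (4 %| n.+1)%N /\ odd k.
Proof.
move=> n_gt1 k_gt0 k_lt; split=> [|[n4 k2]].
  case/(@occurs_grid _ _ _ ord0 1 1 n_gt1 k_gt0 k_lt).
    by case=> -[|[|//]] i2; rewrite mxE.
  rewrite muln1 => n4 [A [B [H hA hB]]]; split=> //.
  have := step_not_dvd H hA hB (horizontal_step perfect_code_up H).
  by rewrite dvdn2 negbK.
apply: (periodic_occurs (d := 4) (p := pred1 0%N) (q := pred1 2%N)
                        (a := 0) (c := 1)) => //.
have [km | km] : (k %% 4 = 1 \/ k %% 4 = 3)%N by lia.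
all: by rewrite /= km.
Qed.

Lemma occurs_A5 n k : (1 < n)%N -> (0 < k)%N -> (2 * k < n.+1)%N ->
  occurs (@GP n.+1 k) A5 <->
  (5 %| n.+1)%N /\ (k = 2 %[mod 5] \/ k + 2 = 0 %[mod 5])%N.
Proof.
move=> n_gt1 k_gt0 k_lt; split=> [|[n5 k5]].
  case/(@occurs_grid _ _ _ ord0 2 2 n_gt1 k_gt0 k_lt).
    by case=> -[|[|//]] i2; rewrite mxE.
  move=> n5 [A [B [H hA hB]]]; split; first by lia.
  exact: mod5_of_grid H hB.
apply: (periodic_occurs (d := 5) (p := pred2 1%N 4%N) (q := pred2 2%N 3%N)
                        (a := 0) (c := 2)) => //.
have [km | km] : (k %% 5 = 2 \/ k %% 5 = 3)%N by lia.
all: by rewrite /= km.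
Qed.

Lemma occurs_A6 n k : (1 < n)%N -> (0 < k)%N -> (2 * k < n.+1)%N ->
  occurs (@GP n.+1 k) A6 <-> (2 %| n.+1)%N /\ odd k.
Proof.
move=> n_gt1 k_gt0 k_lt; split=> [|[n2 k2]].
  case/(@occurs_grid _ _ _ ord0 3 3 n_gt1 k_gt0 k_lt).
    by case=> -[|[|//]] i2; rewrite mxE.
  move=> n2 [A [B [H hA hB]]]; split; first by lia.
  exact: bipartite_odd H hA.
apply: (periodic_occurs (d := 2) (p := pred1 0%N) (q := pred1 1%N)
                        (a := 0) (c := 3)) => //.
have km : (k %% 2 = 1)%N by lia.
by rewrite /= km.
Qed.

Local Close Scope ring_scope.

Theorem theorem1 (n k : nat) (hn : 3 <= n) (hk : 1 <= k) (hkn : 2 * k < n) :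
  (forall S : 'M[nat]_2, occurs (@GP n k) S ->
     exists2 A : 'M[nat]_2, A \in [:: A1; A2; A3; A4; A5; A6]
                          & S = A \/ S = swap_colors A)
  /\ occurs (@GP n k) A1
  /\ (occurs (@GP n k) A2 <-> (3 %| n) /\ ~ (3 %| k))
  /\ (occurs (@GP n k) A3 <-> (2 %| n) /\ odd k)
  /\ (occurs (@GP n k) A4 <-> (4 %| n) /\ odd k)
  /\ (occurs (@GP n k) A5 <->
        (5 %| n) /\ (k = 2 %[mod 5] \/ k + 2 = 0 %[mod 5]))
  /\ (occurs (@GP n k) A6 <-> (2 %| n) /\ odd k).
Proof.
case: n hn hkn => // n n_gt1 k_lt.
split; first by move=> S; apply: occurs_classified.
split; first exact: occurs_A1.
split; first exact: occurs_A2.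
split; first exact: occurs_A3.
split; first exact: occurs_A4.
split; first exact: occurs_A5.
exact: occurs_A6.
Qed.
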